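(* Let $\mathcal{C}$ be a duoidal category with structure $(\circ,I,\bullet,J,\zeta,\delta,\varpi,\tau)$, having coequalizers and such that every object of $\mathcal{C}^\circ=(\mathcal{C},\circ,I)$ is coflat. Let $R,S$ be algebras in $\mathcal{C}^\circ$ such that the functors $-\circ R:\mathcal{C}\to\mathcal{C}_R$ and $-\circ S:\mathcal{C}\to\mathcal{C}_S$ are semiseparable (resp., naturally full). Suppose $\delta:I\to I\bullet I$ is a split-epi. Then the functor $-\circ(R\bullet S):\mathcal{C}\to\mathcal{C}_{R\bullet S}$ is semiseparable (resp., naturally full).
   Context: A duoidal category is a category $\mathcal{C}$ with two monoidal structures $\mathcal{C}^\circ=(\mathcal{C},\circ,I)$ and $\mathcal{C}^\bullet=(\mathcal{C},\bullet,J)$, a natural transformation $\zeta_{A,B,C,D}:(A\bullet B)\circ(C\bullet D)\to(A\circ C)\bullet(B\circ D)$ and morphisms $\delta:I\to I\bullet I$, $\varpi:J\circ J\to J$, $\tau:I\to J$ such that $(J,\varpi,\tau)$ is an algebra in $\mathcal{C}^\circ$, $(I,\delta,\tau)$ is a coalgebra in $\mathcal{C}^\bullet$, and (associativity constraints suppressed, composition written by juxtaposition, $l^\circ,r^\circ,l^\bullet,r^\bullet$ the unit constraints) $\zeta_{A,B,C\circ E,D\circ F}(\mathrm{Id}_{A\bullet B}\circ\zeta_{C,D,E,F})=\zeta_{A\circ C,B\circ D,E,F}(\zeta_{A,B,C,D}\circ\mathrm{Id}_{E\bullet F})$, $(\mathrm{Id}_{A\circ D}\bullet\zeta_{B,C,E,F})\zeta_{A,B\bullet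 C,D,E\bullet F}=(\zeta_{A,B,D,E}\bullet\mathrm{Id}_{C\circ F})\zeta_{A\bullet B,C,D\bullet E,F}$, $(l^\circ_A\bullet l^\circ_B)\zeta_{I,I,A,B}(\delta\circ\mathrm{Id}_{A\bullet B})=l^\circ_{A\bullet B}$, $(r^\circ_A\bullet r^\circ_B)\zeta_{A,B,I,I}(\mathrm{Id}_{A\bullet B}\circ\delta)=r^\circ_{A\bullet B}$, $l^\bullet_{A\circ B}(\varpi\bullet\mathrm{Id}_{A\circ B})\zeta_{J,A,J,B}=l^\bullet_A\circ l^\bullet_B$, $r^\bullet_{A\circ B}(\mathrm{Id}_{A\circ B}\bullet\varpi)\zeta_{A,J,B,J}=r^\bullet_A\circ r^\bullet_B$. For algebras $(A,m_A,u_A)$, $(B,m_B,u_B)$ in $\mathcal{C}^\circ$, $A\bullet B$ is an algebra in $\mathcal{C}^\circ$ with multiplication $(m_A\bullet m_B)\zeta_{A,B,A,B}$ and unit $(u_A\bullet u_B)\delta$. For an algebra $A$ in $\mathcal{C}^\circ$, $\mathcal{C}_A$ is the category of right $A$-modules in $\mathcal{C}^\circ$, and $-\circ A:\mathcal{C}\to\mathcal{C}_A$ sends $M$ to $M\circ A$ with action $\mathrm{Id}_M\circ m_A$. An object $X$ of $\mathcal{C}^\circ$ is coflat if $X\circ-$ and $-\circ X$ preserve coequalizers. A functor $F:\mathcal{A}\to\mathcal{B}$ induces the natural transformation $\mathcal{F}:\mathrm{Hom}_{\mathcal{A}}(-,-)\to\mathrm{Hom}_{\mathcal{B}}(F-,F-)$,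 $f\mapsto F(f)$. $F$ is naturally full (resp. semiseparable) if there is a natural transformation $\mathcal{P}:\mathrm{Hom}_{\mathcal{B}}(F-,F-)\to\mathrm{Hom}_{\mathcal{A}}(-,-)$ such that $\mathcal{P}$ followed by $\mathcal{F}$ is the identity (resp. $\mathcal{F}$ followed by $\mathcal{P}$ followed by $\mathcal{F}$ equals $\mathcal{F}$). *)

(* Defs.v *)
From Stdlib Require Import ssreflect ProofIrrelevance.

Set Implicit Arguments.
Unset Strict Implicit.
Unset Printing Implicit Defensive.

Record category := Category {
  ob :> Type;
  hom : ob -> ob -> Type;
  idm : forall A, hom A A;
  comp : forall A B C, hom B C -> hom A B -> hom A C;
  comp_idl : forall A B (f : hom A B), comp (idm B) f = f;
  comp_idr : forall A B (f : hom A B), comp f (idm A) = f;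
  comp_assoc : forall A B C D (h : hom C D) (g : hom B C) (f : hom A B),
    comp h (comp g f) = comp (comp h g) f
}.

Arguments hom {c} A B.
Arguments idm {c} A.
Arguments comp {c A B C} g f.

Notation "g · f" := (comp g f) (at level 40, left associativity).

Record iso (C : category) (A B : C) := Iso {
  iso_hom :> hom A B;
  iso_inv : hom B A;
  iso_homK : iso_inv · iso_hom = idm A;
  iso_invK : iso_hom · iso_inv = idm B
}.

Definition split_epi (C : category) (A B : C) (f : hom A B) : Prop :=
  exists s : hom B A, f · s = idm B.

Definition is_coequalizer (C : category) (A B Q : C) (f g : hom A B)
    (q : hom B Q) : Prop :=
  q · f = q · g /\
  forall (X : C) (h : hom B X), h · f = h · g ->
    exists! k : hom Q X, k · q = h.

Definition has_coequalizers (C : category) : Prop :=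
  forall (A B : C) (f g : hom A B),
    exists (Q : C) (q : hom B Q), is_coequalizer f g q.

Record functor (C D : category) := Functor {
  fobj :> C -> D;
  fmap : forall A B, hom A B -> hom (fobj A) (fobj B);
  fmap_id : forall A, fmap (idm A) = idm (fobj A);
  fmap_comp : forall A B X (g : hom B X) (f : hom A B),
    fmap (g · f) = fmap g · fmap f
}.

Arguments fmap {C D} f0 {A B} f.

Definition preserves_coequalizers (C D : category) (F : functor C D) : Prop :=
  forall (A B Q : C) (f g : hom A B) (q : hom B Q),
    is_coequalizer f g q -> is_coequalizer (fmap F f) (fmap F g) (fmap F q).

(** Natural transformations [Hom_D (F -, F -) -> Hom_C (-, -)] between functors
    on [C^op * C]; naturality is stated jointly in both variables. *)
Record hom_trans (C D : category) (F : functor C D) := HomTrans {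
  hom_trans_map :> forall X Y : C, hom (F X) (F Y) -> hom X Y;
  hom_trans_natural : forall (X' X Y Y' : C) (h : hom X' X) (g : hom Y Y')
      (f : hom (F X) (F Y)),
    hom_trans_map (fmap F g · f · fmap F h) = g · hom_trans_map f · h
}.

Definition naturally_full (C D : category) (F : functor C D) : Prop :=
  exists P : hom_trans F,
    forall (X Y : C) (f : hom (F X) (F Y)), fmap F (P X Y f) = f.

Definition semiseparable (C D : category) (F : functor C D) : Prop :=
  exists P : hom_trans F,
    forall (X Y : C) (f : hom X Y), fmap F (P X Y (fmap F f)) = fmap F f.

Record bifunctor (C : category) := Bifunctor {
  tens : C -> C -> C;
  tensm : forall A A' B B', hom A A' -> hom B B' -> hom (tens A B) (tens A' B');
  tensm_id : forall A B, tensm (idm A) (idm B) = idm (tens A B);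
  tensm_comp : forall A A' A'' B B' B'' (f' : hom A' A'') (f : hom A A')
      (g' : hom B' B'') (g : hom B B'),
    tensm (f' · f) (g' · g) = tensm f' g' · tensm f g
}.

Arguments tens {C} b A B.
Arguments tensm {C} b {A A' B B'} f g.

Notation "A ⊗[ T ] B" := (tens T A B)
  (at level 35, no associativity, format "A  ⊗[ T ]  B").
Notation "f ⊠[ T ] g" := (tensm T f g)
  (at level 35, no associativity, format "f  ⊠[ T ]  g").

(** Not assumed strict: the constraints [assoc], [lunit], [runit] are natural
    isomorphisms subject to the pentagon and triangle axioms. *)
Record monoidal (C : category) := Monoidal {
  tensor :> bifunctor C;
  munit : C;
  assoc : forall A B X,
    iso ((A ⊗[tensor] B) ⊗[tensor] X) (A ⊗[tensor] (B ⊗[tensor] X));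
  lunit : forall A, iso (munit ⊗[tensor] A) A;
  runit : forall A, iso (A ⊗[tensor] munit) A;
  assoc_natural : forall A A' B B' X X'
      (f : hom A A') (g : hom B B') (h : hom X X'),
    assoc A' B' X' · ((f ⊠[tensor] g) ⊠[tensor] h)
    = (f ⊠[tensor] (g ⊠[tensor] h)) · assoc A B X;
  lunit_natural : forall A A' (f : hom A A'),
    lunit A' · (idm munit ⊠[tensor] f) = f · lunit A;
  runit_natural : forall A A' (f : hom A A'),
    runit A' · (f ⊠[tensor] idm munit) = f · runit A;
  pentagon : forall A B X Y,
    assoc A B (X ⊗[tensor] Y) · assoc (A ⊗[tensor] B) X Y
    = (idm A ⊠[tensor] assoc B X Y) · assoc A (B ⊗[tensor] X) Y
      · (assoc A B X ⊠[tensor] idm Y);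
  triangle : forall A B,
    (idm A ⊠[tensor] lunit B) · assoc A munit B = runit A ⊠[tensor] idm B
}.

Arguments munit {C} m.
Arguments assoc {C} m A B X.
Arguments lunit {C} m A.
Arguments runit {C} m A.

Lemma ltens_comp (C : category) (M : monoidal C) (X A B D : C)
    (g : hom B D) (f : hom A B) :
  idm X ⊠[M] (g · f) = (idm X ⊠[M] g) · (idm X ⊠[M] f).
Proof. by rewrite -tensm_comp comp_idl. Qed.

Lemma rtens_comp (C : category) (M : monoidal C) (X A B D : C)
    (g : hom B D) (f : hom A B) :
  (g · f) ⊠[M] idm X = (g ⊠[M] idm X) · (f ⊠[M] idm X).
Proof. by rewrite -tensm_comp comp_idl. Qed.

Definition ltens (C : category) (M : monoidal C) (X : C) : functor C C :=
  @Functor C C (fun A => X ⊗[M] A) (fun A B f => idm X ⊠[M] f)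
    (fun A => tensm_id M X A) (fun A B D g f => ltens_comp M X g f).

Definition rtens (C : category) (M : monoidal C) (X : C) : functor C C :=
  @Functor C C (fun A => A ⊗[M] X) (fun A B f => f ⊠[M] idm X)
    (fun A => tensm_id M A X) (fun A B D g f => rtens_comp M X g f).

Definition coflat (C : category) (M : monoidal C) (X : C) : Prop :=
  preserves_coequalizers (ltens M X) /\ preserves_coequalizers (rtens M X).

Record is_algebra (C : category) (M : monoidal C) (A : C)
    (m : hom (A ⊗[M] A) A) (u : hom (munit M) A) : Prop := IsAlgebra {
  alg_assoc : m · (m ⊠[M] idm A) = m · (idm A ⊠[M] m) · assoc M A A A;
  alg_unitl : m · (u ⊠[M] idm A) = lunit M A;
  alg_unitr : m · (idm A ⊠[M] u) = runit M A
}.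

Record is_coalgebra (C : category) (M : monoidal C) (A : C)
    (d : hom A (A ⊗[M] A)) (e : hom A (munit M)) : Prop := IsCoalgebra {
  coalg_assoc : assoc M A A A · (d ⊠[M] idm A) · d = (idm A ⊠[M] d) · d;
  coalg_unitl : lunit M A · (e ⊠[M] idm A) · d = idm A;
  coalg_unitr : runit M A · (idm A ⊠[M] e) · d = idm A
}.

Record algebra (C : category) (M : monoidal C) := Algebra {
  alg_ob :> C;
  alg_mul : hom (alg_ob ⊗[M] alg_ob) alg_ob;
  alg_unit : hom (munit M) alg_ob;
  algP : is_algebra alg_mul alg_unit
}.

Record rmodule (C : category) (M : monoidal C) (A : algebra M) := RModule {
  rmod_ob :> C;
  rmod_act : hom (rmod_ob ⊗[M] A) rmod_ob;
  rmod_assoc : rmod_act · (rmod_act ⊠[M] idm (A : C))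
    = rmod_act · (idm rmod_ob ⊠[M] alg_mul A) · assoc M rmod_ob A A;
  rmod_unit : rmod_act · (idm rmod_ob ⊠[M] alg_unit A) = runit M rmod_ob
}.

Record rmod_hom (C : category) (M : monoidal C) (A : algebra M)
    (X Y : rmodule A) := RModHom {
  rmod_hom_val :> hom (X : C) Y;
  rmod_homP : rmod_hom_val · rmod_act X
    = rmod_act Y · (rmod_hom_val ⊠[M] idm (A : C))
}.

Lemma rmod_hom_eq (C : category) (M : monoidal C) (A : algebra M)
    (X Y : rmodule A) (f g : rmod_hom X Y) :
  f = g :> hom (X : C) Y -> f = g.
Proof.
case: f g => f fP [g gP] /= efg; subst g.
by rewrite (proof_irrelevance _ fP gP).
Qed.

Lemma rmod_idP (C : category) (M : monoidal C) (A : algebra M)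
    (X : rmodule A) :
  idm (X : C) · rmod_act X = rmod_act X · (idm (X : C) ⊠[M] idm (A : C)).
Proof. by rewrite tensm_id comp_idl comp_idr. Qed.

Lemma rmod_compP (C : category) (M : monoidal C) (A : algebra M)
    (X Y Z : rmodule A) (g : rmod_hom Y Z) (f : rmod_hom X Y) :
  (g · f) · rmod_act X = rmod_act Z · ((g · f) ⊠[M] idm (A : C)).
Proof.
by rewrite rtens_comp comp_assoc -rmod_homP -!comp_assoc -rmod_homP.
Qed.

Definition rmod_id (C : category) (M : monoidal C) (A : algebra M)
    (X : rmodule A) : rmod_hom X X := RModHom (rmod_idP X).

Definition rmod_comp (C : category) (M : monoidal C) (A : algebra M)
    (X Y Z : rmodule A) (g : rmod_hom Y Z) (f : rmod_hom X Y) : rmod_hom X Z :=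
  RModHom (rmod_compP g f).

Lemma rmod_comp_idl (C : category) (M : monoidal C) (A : algebra M)
    (X Y : rmodule A) (f : rmod_hom X Y) : rmod_comp (rmod_id Y) f = f.
Proof. by apply: rmod_hom_eq; exact: comp_idl. Qed.

Lemma rmod_comp_idr (C : category) (M : monoidal C) (A : algebra M)
    (X Y : rmodule A) (f : rmod_hom X Y) : rmod_comp f (rmod_id X) = f.
Proof. by apply: rmod_hom_eq; exact: comp_idr. Qed.

Lemma rmod_comp_assoc (C : category) (M : monoidal C) (A : algebra M)
    (X Y Z W : rmodule A) (h : rmod_hom Z W) (g : rmod_hom Y Z)
    (f : rmod_hom X Y) :
  rmod_comp h (rmod_comp g f) = rmod_comp (rmod_comp h g) f.
Proof. by apply: rmod_hom_eq; exact: comp_assoc. Qed.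

Definition rmod_cat (C : category) (M : monoidal C) (A : algebra M) :
    category :=
  @Category (rmodule A) (@rmod_hom C M A) (@rmod_id C M A) (@rmod_comp C M A)
    (@rmod_comp_idl C M A) (@rmod_comp_idr C M A) (@rmod_comp_assoc C M A).

Lemma iso_cancell (C : category) (A B X : C) (i : iso A B) (f g : hom X A) :
  i · f = i · g -> f = g.
Proof.
move=> e; rewrite -(comp_idl f) -(comp_idl g) -(iso_homK i).
by rewrite -!comp_assoc e.
Qed.

Lemma iso_cancelr (C : category) (A B X : C) (i : iso A B) (f g : hom B X) :
  f · i = g · i -> f = g.
Proof.
move=> e; rewrite -(comp_idr f) -(comp_idr g) -(iso_invK i).
by rewrite !comp_assoc e.
Qed.

(** Kelly's consequence of the pentagon and triangle axioms. *)
Lemma runit_tens (C : category) (M : monoidal C) (X A : C) :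
  (idm X ⊠[M] runit M A) · assoc M X A (munit M) = runit M (X ⊗[M] A).
Proof.
have faithful (Y Z : C) (f g : hom Y Z) :
    f ⊠[M] idm (munit M) = g ⊠[M] idm (munit M) -> f = g.
  move=> e; apply: (@iso_cancelr _ _ _ _ (runit M Y)).
  by rewrite -!runit_natural e.
apply: faithful; apply: (@iso_cancell _ _ _ _ (assoc M X A (munit M))).
rewrite -triangle rtens_comp !comp_assoc -tensm_id assoc_natural.
rewrite assoc_natural -[in RHS]comp_assoc pentagon -triangle ltens_comp.
by rewrite !comp_assoc.
Qed.

(** [Id_X ∘ m_A], up to the associativity constraint. *)
Definition free_act (C : category) (M : monoidal C) (A : algebra M) (X : C) :
    hom ((X ⊗[M] A) ⊗[M] A) (X ⊗[M] A) :=
  (idm X ⊠[M] alg_mul A) · assoc M X A A.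

Lemma free_assoc (C : category) (M : monoidal C) (A : algebra M) (X : C) :
  free_act A X · (free_act A X ⊠[M] idm (A : C))
  = free_act A X · (idm (X ⊗[M] A) ⊠[M] alg_mul A) · assoc M (X ⊗[M] A) A A.
Proof.
rewrite /free_act rtens_comp !comp_assoc.
rewrite -[_ · assoc M X A A · (_ ⊠[M] _)]comp_assoc assoc_natural.
rewrite !comp_assoc -ltens_comp (alg_assoc (algP A)) !ltens_comp.
rewrite -[_ · assoc M X A A · (_ ⊠[M] _)]comp_assoc -tensm_id assoc_natural.
rewrite !comp_assoc -[in RHS]comp_assoc pentagon.
by rewrite !comp_assoc.
Qed.

Lemma free_unit (C : category) (M : monoidal C) (A : algebra M) (X : C) :
  free_act A X · (idm (X ⊗[M] A) ⊠[M] alg_unit A) = runit M (X ⊗[M] A).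
Proof.
rewrite /free_act -comp_assoc -tensm_id assoc_natural comp_assoc.
by rewrite -ltens_comp (alg_unitr (algP A)) runit_tens.
Qed.

Definition free_rmod (C : category) (M : monoidal C) (A : algebra M) (X : C) :
    rmodule A := RModule (free_assoc A X) (free_unit A X).

Lemma free_homP (C : category) (M : monoidal C) (A : algebra M) (X Y : C)
    (f : hom X Y) :
  (f ⊠[M] idm (A : C)) · rmod_act (free_rmod A X)
  = rmod_act (free_rmod A Y) · ((f ⊠[M] idm (A : C)) ⊠[M] idm (A : C)).
Proof.
rewrite /= /free_act -[in RHS]comp_assoc assoc_natural !comp_assoc.
by rewrite tensm_id -!tensm_comp !comp_idl !comp_idr.
Qed.

Definition free_hom (C : category) (M : monoidal C) (A : algebra M) (X Y : C)
    (f : hom X Y) : rmod_hom (free_rmod A X) (free_rmod A Y) :=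
  @RModHom C M A (free_rmod A X) (free_rmod A Y) _ (free_homP A f).

Lemma free_hom_id (C : category) (M : monoidal C) (A : algebra M) (X : C) :
  free_hom A (idm X) = rmod_id (free_rmod A X).
Proof. by apply: rmod_hom_eq; exact: tensm_id. Qed.

Lemma free_hom_comp (C : category) (M : monoidal C) (A : algebra M)
    (X Y Z : C) (g : hom Y Z) (f : hom X Y) :
  free_hom A (g · f) = rmod_comp (free_hom A g) (free_hom A f).
Proof. by apply: rmod_hom_eq; exact: rtens_comp. Qed.

Definition free_functor (C : category) (M : monoidal C) (A : algebra M) :
    functor C (rmod_cat A) :=
  @Functor C (rmod_cat A) (free_rmod A) (@free_hom C M A)
    (free_hom_id A) (fun X Y Z g f => @free_hom_comp C M A X Y Z g f).

Record bimonoidal := BiMonoidal {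
  bim_cat :> category;
  circ : monoidal bim_cat;
  bullet : monoidal bim_cat
}.

Arguments circ {b}.
Arguments bullet {b}.

Notation "A ∘ B" := (tens circ A B) (at level 35, no associativity).
Notation "A • B" := (tens bullet A B) (at level 35, no associativity).
Notation "f [∘] g" := (tensm circ f g) (at level 35, no associativity).
Notation "f [•] g" := (tensm bullet f g) (at level 35, no associativity).

(** [zeta_assoc_circ] and [zeta_assoc_bullet] hold up to the associativity
    constraints of [∘] and [•], inserted here explicitly. *)
Record duoidal := Duoidal {
  duo_base :> bimonoidal;
  zeta : forall A B C D : duo_base,
    hom ((A • B) ∘ (C • D)) ((A ∘ C) • (B ∘ D));
  delta : hom (munit circ) ((munit circ : duo_base) • munit circ);
  varpi : hom ((munit bullet : duo_base) ∘ munit bullet) (munit bullet);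
  tau : hom (munit circ : duo_base) (munit bullet);
  zeta_natural : forall (A A' B B' C C' D D' : duo_base)
      (f : hom A A') (g : hom B B') (h : hom C C') (k : hom D D'),
    zeta A' B' C' D' · ((f [•] g) [∘] (h [•] k))
    = ((f [∘] h) [•] (g [∘] k)) · zeta A B C D;
  varpi_algebra : @is_algebra duo_base circ (munit bullet) varpi tau;
  delta_coalgebra : @is_coalgebra duo_base bullet (munit circ) delta tau;
  zeta_assoc_circ : forall A B C D E F : duo_base,
    zeta A B (C ∘ E) (D ∘ F) · (idm (A • B) [∘] zeta C D E F)
      · assoc circ (A • B) (C • D) (E • F)
    = (assoc circ A C E [•] assoc circ B D F)
      · zeta (A ∘ C) (B ∘ D) E F · (zeta A B C D [∘] idm (E • F));
  zeta_assoc_bullet : forall A B C D E F : duo_base,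
    (idm (A ∘ D) [•] zeta B C E F) · zeta A (B • C) D (E • F)
      · (assoc bullet A B C [∘] assoc bullet D E F)
    = assoc bullet (A ∘ D) (B ∘ E) (C ∘ F)
      · (zeta A B D E [•] idm (C ∘ F)) · zeta (A • B) C (D • E) F;
  zeta_lunit_circ : forall A B : duo_base,
    (lunit circ A [•] lunit circ B) · zeta (munit circ) (munit circ) A B
      · (delta [∘] idm (A • B))
    = lunit circ (A • B);
  zeta_runit_circ : forall A B : duo_base,
    (runit circ A [•] runit circ B) · zeta A B (munit circ) (munit circ)
      · (idm (A • B) [∘] delta)
    = runit circ (A • B);
  zeta_lunit_bullet : forall A B : duo_base,
    lunit bullet (A ∘ B) · (varpi [•] idm (A ∘ B))
      · zeta (munit bullet) A (munit bullet) B
    = lunit bullet A [∘] lunit bullet B;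
  zeta_runit_bullet : forall A B : duo_base,
    runit bullet (A ∘ B) · (idm (A ∘ B) [•] varpi)
      · zeta A (munit bullet) B (munit bullet)
    = runit bullet A [∘] runit bullet B
}.

Arguments zeta {d} A B C D.
Arguments delta {d}.
Arguments varpi {d}.
Arguments tau {d}.

Definition bullet_mul (C : duoidal) (R S : algebra (@circ C)) :
    hom (((R : C) • S) ∘ ((R : C) • S)) ((R : C) • S) :=
  (alg_mul R [•] alg_mul S) · zeta (R : C) S R S.

Definition bullet_unit (C : duoidal) (R S : algebra (@circ C)) :
    hom (munit circ) ((R : C) • S) :=
  (alg_unit R [•] alg_unit S) · delta.

Lemma bullet_algebraP (C : duoidal) (R S : algebra (@circ C)) :
  is_algebra (bullet_mul R S) (bullet_unit R S).
Proof.
have nl (A A' B B' D E : C) (f : hom A A') (g : hom B B') :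
    zeta A' B' D E · ((f [•] g) [∘] idm (D • E))
    = ((f [∘] idm D) [•] (g [∘] idm E)) · zeta A B D E.
  by rewrite -(tensm_id (@bullet C)) zeta_natural.
have nr (A A' B B' D E : C) (f : hom A A') (g : hom B B') :
    zeta D E A' B' · (idm (D • E) [∘] (f [•] g))
    = ((idm D [∘] f) [•] (idm E [∘] g)) · zeta D E A B.
  by rewrite -(tensm_id (@bullet C)) zeta_natural.
split.
- rewrite /bullet_mul rtens_comp ltens_comp !comp_assoc.
  rewrite -[_ · zeta _ _ _ _ · ((_ [•] _) [∘] _)]comp_assoc nl.
  rewrite -[_ · zeta _ _ _ _ · (_ [∘] (_ [•] _))]comp_assoc nr.
  rewrite !comp_assoc -!tensm_comp !(alg_assoc (algP _)) !tensm_comp.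
  by rewrite -!comp_assoc; do !congr comp; rewrite !comp_assoc zeta_assoc_circ.
- rewrite /bullet_mul /bullet_unit rtens_comp !comp_assoc.
  rewrite -[_ · zeta _ _ _ _ · ((_ [•] _) [∘] _)]comp_assoc nl.
  by rewrite !comp_assoc -tensm_comp !(alg_unitl (algP _)) zeta_lunit_circ.
- rewrite /bullet_mul /bullet_unit ltens_comp !comp_assoc.
  rewrite -[_ · zeta _ _ _ _ · (_ [∘] (_ [•] _))]comp_assoc nr.
  by rewrite !comp_assoc -tensm_comp !(alg_unitr (algP _)) zeta_runit_circ.
Qed.

Definition bullet_algebra (C : duoidal) (R S : algebra (@circ C)) :
    algebra (@circ C) := Algebra (bullet_algebraP R S).

(* Main.v *)
(** The functor [- ∘ A] is semiseparable exactly when the unit [u : I -> A] is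
    regular ([u E u = u] for some [E : A -> I]), and naturally full exactly when
    [u] is a split epimorphism: [E] is obtained by applying the natural
    transformation to the counit [(I ∘ A) ∘ A -> I ∘ A] of the free-forgetful
    adjunction.  If [E_R], [E_S] are such maps for [R], [S] and [s] is a section
    of [delta], then [s (E_R • E_S)] is one for [R • S]. *)
From Stdlib Require Import ssreflect.
Require Import Defs.

Set Implicit Arguments.
Unset Strict Implicit.
Unset Printing Implicit Defensive.

(** Lets the cancellation lemmas for isomorphisms be applied to an inverse. *)
Definition iso_sym (C : category) (A B : C) (i : iso A B) : iso B A :=
  Iso (iso_invK i) (iso_homK i).

Section FreeModules.

Variables (C : category) (M : monoidal C) (A : algebra M).

Let I : C := munit M.
Let u : hom I A := alg_unit A.

(** Tensoring with [I] on the left is faithful, as [lunit] is a natural isomorphism. The triangle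
    axiom and [runit_tens] then leave only naturality of [runit] at [runit M I]. *)
Lemma lunit_munit : lunit M I = runit M I :> hom (I ⊗[M] I) I.
Proof.
have faithful (f g : hom (I ⊗[M] I) I) :
    idm I ⊠[M] f = idm I ⊠[M] g -> f = g.
  move=> e; apply: (iso_cancelr (i := lunit M (I ⊗[M] I))).
  by rewrite -!lunit_natural e.
apply: faithful; apply: (iso_cancelr (i := assoc M I I I)).
rewrite triangle runit_tens; apply: (iso_cancell (i := runit M I)).
exact: runit_natural.
Qed.

(** The unit of the free-forgetful adjunction. *)
Definition free_eta (X : C) : hom X (X ⊗[M] A) :=
  (idm X ⊠[M] u) · iso_inv (runit M X).

Lemma runit_inv_natural (X Y : C) (g : hom X Y) :
  (g ⊠[M] idm I) · iso_inv (runit M X) = iso_inv (runit M Y) · g.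
Proof.
apply: (iso_cancell (i := runit M Y)).
by rewrite !comp_assoc runit_natural iso_invK comp_idl -comp_assoc iso_invK
           comp_idr.
Qed.

Lemma free_eta_natural (X Y : C) (g : hom X Y) :
  (g ⊠[M] idm (A : C)) · free_eta X = free_eta Y · g.
Proof.
rewrite /free_eta -comp_assoc -runit_inv_natural !comp_assoc -!tensm_comp.
by rewrite !comp_idl !comp_idr.
Qed.

Lemma free_act_eta (X : C) :
  free_act A X · (free_eta X ⊠[M] idm (A : C)) = idm (X ⊗[M] A).
Proof.
rewrite /free_act /free_eta rtens_comp comp_assoc.
rewrite -[_ · assoc M X A A · _]comp_assoc assoc_natural comp_assoc.
rewrite -ltens_comp (alg_unitl (algP A)) triangle -rtens_comp iso_invK.
exact: tensm_id.
Qed.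

(** Linearity of [f] moves the action to the source, where the triangle identity [free_act_eta]
    cancels it. Hence maps out of a free module may be compared after [free_eta]. *)
Lemma rmod_hom_free (X : C) (Y : rmodule A) (f : rmod_hom (free_rmod A X) Y) :
  rmod_act Y · ((f · free_eta X) ⊠[M] idm (A : C)) = f.
Proof.
by rewrite rtens_comp comp_assoc -rmod_homP -comp_assoc /= free_act_eta
           comp_idr.
Qed.

Lemma rmod_hom_free_eq (X : C) (Y : rmodule A)
    (f g : rmod_hom (free_rmod A X) Y) :
  f · free_eta X = g · free_eta X -> f = g.
Proof.
by move=> e; apply: rmod_hom_eq; rewrite -(rmod_hom_free f) e rmod_hom_free.
Qed.

Lemma free_retract_natural (E : hom A I) (X' X Y Y' : C) (h : hom X' X)
    (g : hom Y Y') (f : hom (X ⊗[M] A) (Y ⊗[M] A)) :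
  runit M Y' · (idm Y' ⊠[M] E)
    · ((g ⊠[M] idm (A : C)) · f · (h ⊠[M] idm (A : C))) · free_eta X'
  = g · (runit M Y · (idm Y ⊠[M] E) · f · free_eta X) · h.
Proof.
rewrite -!comp_assoc free_eta_natural !comp_assoc; do 4!congr comp.
rewrite -runit_natural -!comp_assoc -!tensm_comp.
by rewrite !comp_idl !comp_idr.
Qed.

(** Any [E] gives a natural candidate for the converse half of both criteria; the equation imposed
    on [u · E] decides which property it has. *)
Definition free_retract (E : hom A I) : hom_trans (free_functor A) :=
  @HomTrans C (rmod_cat A) (free_functor A)
    (fun X Y (f : rmod_hom _ _) =>
       runit M Y · (idm Y ⊠[M] E) · f · free_eta X)
    (fun X' X Y Y' h g f => free_retract_natural E h g f).

(** By naturality of [free_eta], the left side is also the image of the retract under the free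
    functor, restricted along the unit. *)
Lemma free_eta_retract (E : hom A I) (X Y : C)
    (f : rmod_hom (free_rmod A X) (free_rmod A Y)) :
  free_eta Y · free_retract E X Y f
  = (idm Y ⊠[M] (u · E)) · f · free_eta X.
Proof.
rewrite /= !comp_assoc; do 2!congr comp.
rewrite ltens_comp /free_eta.
by rewrite -[_ · iso_inv _ · runit M Y]comp_assoc iso_homK comp_idr.
Qed.

Lemma free_eta_munit : free_eta I = iso_inv (lunit M A) · u.
Proof.
apply: (iso_cancell (i := lunit M A)).
rewrite /free_eta !comp_assoc iso_invK comp_idl lunit_natural lunit_munit.
by rewrite -comp_assoc iso_invK comp_idr.
Qed.

Lemma free_act_homP (X : C) :
  free_act A X · rmod_act (free_rmod A (X ⊗[M] A))
  = rmod_act (free_rmod A X) · (free_act A X ⊠[M] idm (A : C)).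
Proof. by rewrite [RHS]free_assoc -comp_assoc. Qed.

Definition free_counit (X : C) :
    rmod_hom (free_rmod A (X ⊗[M] A)) (free_rmod A X) :=
  @RModHom C M A (free_rmod A (X ⊗[M] A)) (free_rmod A X) _ (free_act_homP X).

Lemma free_counit_eta (X : C) :
  rmod_comp (free_counit X) (free_hom A (free_eta X)) = rmod_id (free_rmod A X).
Proof. by apply: rmod_hom_eq; exact: free_act_eta. Qed.

Definition counit_map (P : hom_trans (free_functor A)) : hom (I ⊗[M] A) I :=
  P (I ⊗[M] A) I (free_counit I).

(** Naturality of [P] in its first variable along [free_eta I] reduces this to the triangle identity
    [free_counit_eta]. *)
Lemma counit_map_eta (P : hom_trans (free_functor A)) :
  counit_map P · free_eta I = P I I (rmod_id (free_rmod A I)).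
Proof.
have e := hom_trans_natural P (free_eta I) (idm I) (free_counit I).
rewrite comp_idl in e; rewrite /counit_map -e.
by rewrite fmap_id comp_idl /= free_counit_eta.
Qed.

Theorem semiseparable_freeP :
  semiseparable (free_functor A) <-> exists E : hom A I, u · E · u = u.
Proof.
split=> [[P PK]|[E uEu]].
- exists (counit_map P · iso_inv (lunit M A)).
  (* Composing with the inverse of [lunit M A] replaces [u] by [free_eta I], which is natural. *)
  apply: (iso_cancell (i := iso_sym (lunit M A))) => /=.
  rewrite -!comp_assoc -free_eta_munit counit_map_eta comp_assoc.
  rewrite -free_eta_munit -free_eta_natural.
  have /(f_equal (@rmod_hom_val _ _ _ _ _)) /= := PK _ _ (idm I).
  by rewrite free_hom_id tensm_id => ->; rewrite comp_idl.
- exists (free_retract E) => X Y g; apply: rmod_hom_free_eq.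
  rewrite [LHS]free_eta_natural free_eta_retract -comp_assoc /=.
  rewrite free_eta_natural comp_assoc; congr comp.
  by rewrite /free_eta comp_assoc -ltens_comp uEu.
Qed.

Theorem naturally_full_freeP :
  naturally_full (free_functor A) <-> exists E : hom A I, u · E = idm (A : C).
Proof.
split=> [[P PK]|[E uE]].
- exists (counit_map P · iso_inv (lunit M A)).
  apply: (iso_cancell (i := iso_sym (lunit M A))) => /=.
  rewrite !comp_assoc -free_eta_munit -free_eta_natural.
  (* Fullness returns the multiplication [free_act A I] itself, and the right unit law of [A] makes
     it a retraction of [free_eta (I ⊗[M] A)]. *)
  have /(f_equal (@rmod_hom_val _ _ _ _ _)) /= := PK _ _ (free_counit I).
  rewrite -/(counit_map P) => ->.
  by rewrite /free_eta !comp_assoc free_unit iso_invK comp_idl comp_idr.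
- exists (free_retract E) => X Y f; apply: rmod_hom_free_eq.
  by rewrite [LHS]free_eta_natural free_eta_retract uE tensm_id comp_idl.
Qed.

End FreeModules.

Theorem proposition5p6 (C : duoidal) (coeqC : has_coequalizers C)
    (coflatC : forall X : C, coflat circ X) (R S : algebra (@circ C))
    (split_delta : split_epi (@delta C)) :
  (semiseparable (free_functor R) -> semiseparable (free_functor S) ->
     semiseparable (free_functor (bullet_algebra R S)))
  /\ (naturally_full (free_functor R) -> naturally_full (free_functor S) ->
     naturally_full (free_functor (bullet_algebra R S))).
Proof.
case: split_delta => s delta_s; split.
- move=> /semiseparable_freeP[E uEu] /semiseparable_freeP[F uFu].
  apply/semiseparable_freeP; exists (s · (E [•] F)).
  rewrite /= /bullet_unit !comp_assoc; congr comp.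
  (* Once [delta · s] cancels, bifunctoriality of [•] separates the equations for [R] and [S]. *)
  rewrite -[_ · delta · s]comp_assoc delta_s comp_idr -!tensm_comp.
  by rewrite uEu uFu.
- move=> /naturally_full_freeP[E uE] /naturally_full_freeP[F uF].
  apply/naturally_full_freeP; exists (s · (E [•] F)).
  rewrite /= /bullet_unit !comp_assoc -[_ · delta · s]comp_assoc.
  by rewrite delta_s comp_idr -tensm_comp uE uF tensm_id.
Qed.
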